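(* Let $\mathcal{Z}$ be a measurable space, $d:\mathcal{Z}\times\mathcal{Z}\to[0,\infty]$ a measurable function with $d(z,z)=0$ for all $z$, $\bm{l}:\mathcal{Z}\times\Theta\to\mathbb{R}$ a loss function, $\theta\in\Theta$, $\mathcal{Z}_N=\{Z^{(1)},\dots,Z^{(N)}\}\subset\mathcal{Z}$ a finite empirical dataset, and $\mathbb{P}_N=\sum_{i=1}^N\mu_i\bm{\chi}_{\{Z^{(i)}\}}$ a probability measure on $\mathcal{Z}$ (the corresponding empirical distribution). Let $1\le p<\infty$, and let $\operatorname{lb}_p,\operatorname{cc}_p$ be as defined in the context. Then exactly one of the following two cases must occur: (1) $\operatorname{lb}_p(\epsilon)=\operatorname{cc}_p(\epsilon)=\infty$ for any $\epsilon>0$; (2) $\operatorname{lb}_p(\epsilon)<\infty$ and $\operatorname{cc}_p(\epsilon)<\infty$ for any $\epsilon>0$. (This claim is not true for $p=\infty$, as $\lim_{t\to\epsilon^+}\Delta_\theta(Z^{(i)},t)$ could be infinite even though $\Delta_\theta(Z^{(i)},\epsilon)<\infty$.)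
   Context: $\bm{\chi}_{\{z\}}$ is the Dirac mass at $z$. Convention: $0\cdot\infty=0$. Individual rate: $\Delta_\theta(z,t)=\sup_{z'\in\mathcal{Z}}\{\bm{l}(z';\theta)-\bm{l}(z;\theta): d(z',z)\le t\}$ for $z\in\mathcal{Z}_N$, $t\ge0$. Maximal rate: $\Delta_\theta^{\max}(t)=\max_{Z^{(i)}\in\mathcal{Z}_N}\Delta_\theta(Z^{(i)},t)$. Majorants: a function $f$ on $[0,\infty)$ is concave if its hypograph $\{(x,y)\in[0,\infty)\times\mathbb{R}: y\le f(x)\}$ is convex; a function $f$ with $f(0)\ge0$ is star-shaped if its hypograph $H$ satisfies $\eta h\in H$ for all $h\in H$, $\eta\in[0,1]$. For a nonnegative $f$ on $[0,\infty)$, the least concave majorant is $\mathcal{C}_f(t)=\inf\{H(t): H\ge f,\ H\text{ concave}\}$ and the least star-shaped majorant is $\mathcal{S}_f(t)=\inf\{H(t): H\ge f,\ H\text{ star-shaped}\}$; both may take the value $+\infty$. For $p<\infty$: $\operatorname{lb}_p(\epsilon)=\sum_{i=1}^N\mu_i\mathcal{S}_{f^{(i)}}(\epsilon^p)$ with $f^{(i)}(t)=\Delta_\theta(Z^{(i)},t^{1/p})$, and $\operatorname{cc}_p(\epsilon)=\mathcal{C}_{f^{\max}}(\epsilon^p)$ with $f^{\max}(t)=\Delta_\theta^{\max}(t^{1/p})$. For $p=\infty$: $\operatorname{lb}_\infty(\epsilon)=\sum_{i=1}^N\mu_i\Delta_\theta(Z^{(i)},\epsilon)$ and $\operatorname{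cc}_\infty(\epsilon)=\sum_{i=1}^N\mu_i\lim_{t\to\epsilon^+}\Delta_\theta(Z^{(i)},t)$.
   Formalization: All weights μ_i are assumed strictly positive; with a zero weight the claim can fail, since a data point of weight 0 contributes 0·∞=0 to lb_p but its full rate to cc_p (so lb_p=0 and cc_p=∞ can occur). *)

(* Defs.v *)
From HB Require Import structures.
From mathcomp Require Import all_boot all_order all_algebra.
From mathcomp Require Import all_classical all_reals all_analysis measurable_realfun.

Set Implicit Arguments.
Unset Strict Implicit.
Unset Printing Implicit Defensive.

Import Order.TTheory GRing.Theory Num.Theory.
Import numFieldNormedType.Exports.

Local Open Scope classical_set_scope.
Local Open Scope ring_scope.
Local Open Scope ereal_scope.

(* Functions on [0, +oo[ are encoded as functions R -> \bar R whose values at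
   negative arguments are never used.  The value +oo is allowed, both for the
   rates and for the functions that majorize them. *)
Section majorants.
Context {R : realType}.
Implicit Types f H : R -> \bar R.

Definition hypograph f : set (R^o * R^o) :=
  [set h | (0 <= h.1)%R /\ h.2%:E <= f h.1].

Definition concave f : Prop :=
  convex_set (hypograph f : set (convex_lmodType (R^o * R^o)%type)).

Definition star_shaped f : Prop :=
  0 <= f 0%R /\
  forall (h : R^o * R^o) (eta : R), hypograph f h ->
    (0 <= eta <= 1)%R -> hypograph f (eta *: h)%R.

Definition majorizes H f : Prop := forall t : R, (0 <= t)%R -> f t <= H t.

Definition least_concave_majorant f (t : R) : \bar R :=
  ereal_inf [set H t | H in [set H | majorizes H f /\ concave H]].

Definition least_star_majorant f (t : R) : \bar R :=
  ereal_inf [set H t | H in [set H | majorizes H f /\ star_shaped H]].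

End majorants.

Section rates.
Context {R : realType} {disp : measure_display} {Z : measurableType disp}
  {Theta : Type}.
Variables (d : Z * Z -> \bar R) (l : Z -> Theta -> R) (theta : Theta).

Definition individual_rate (z : Z) (t : R) : \bar R :=
  ereal_sup [set (l z' theta - l z theta)%:E | z' in [set z' | d (z', z) <= t%:E]].

Variables (N : nat) (data : 'I_N -> Z) (mu : 'I_N -> R).

Definition maximal_rate (t : R) : \bar R :=
  \big[maxe/-oo]_(i < N) individual_rate (data i) t.

Definition lb (p eps : R) : \bar R :=
  \sum_(i < N) (mu i)%:E *
    least_star_majorant (fun t => individual_rate (data i) (t `^ p^-1)%R)
      (eps `^ p)%R.

Definition cc (p eps : R) : \bar R :=
  least_concave_majorant (fun t => maximal_rate (t `^ p^-1)%R) (eps `^ p)%R.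

Definition lb_infty (eps : R) : \bar R :=
  \sum_(i < N) (mu i)%:E * individual_rate (data i) eps.

(* The rates are nondecreasing, so the right limits exist in \bar R. *)
Definition cc_infty (eps : R) : \bar R :=
  \sum_(i < N) (mu i)%:E * lim (individual_rate (data i) t @[t --> eps^'+]).

End rates.

Definition ground_cost {R : realType} {disp : measure_display}
    {Z : measurableType disp} (d : Z * Z -> \bar R) : Prop :=
  [/\ measurable_fun setT d, (forall zz, 0 <= d zz) & (forall z, d (z, z) = 0)].

(* Weights are positive: a point of weight zero is not in the data set.  Such a
   point would contribute 0 * oo = 0 to lb but its full rate to cc. *)
Definition empirical_distribution {R : realType} {disp : measure_display}
    {Z : measurableType disp} (N : nat) (data : 'I_N -> Z) (mu : 'I_N -> R)
    (P : probability Z R) : Prop :=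
  (forall i, (0 < mu i)%R) /\
  forall A : set Z, measurable A ->
    P A = \sum_(i < N) (mu i)%:E * \d_(data i) A.

Definition both_infinite {R : realType} (f g : R -> \bar R) : Prop :=
  forall eps : R, (0 < eps)%R -> f eps = +oo /\ g eps = +oo.

Definition both_finite {R : realType} (f g : R -> \bar R) : Prop :=
  forall eps : R, (0 < eps)%R -> f eps < +oo /\ g eps < +oo.

Definition exactly_one (A B : Prop) : Prop := (A \/ B) /\ ~ (A /\ B).

(* Main.v *)
Require Import Defs.
From HB Require Import structures.
From mathcomp Require Import all_boot all_order all_algebra.
From mathcomp Require Import all_classical all_reals all_analysis measurable_realfun.
From mathcomp Require Import lra.
Import Order.TTheory GRing.Theory Num.Theory.
Import numFieldNormedType.Exports.
Local Open Scope classical_set_scope.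
Local Open Scope ring_scope.
Local Open Scope ereal_scope.

(* Both implications between finiteness and affine growth go through one remark:
   a star-shaped majorant H with H(s) < oo at some s > 0 satisfies
   H(t) <= (t / s) H(s) for t >= s, because (t, y) in the hypograph contracts to
   (s, (s / t) y).  A nondecreasing f >= 0 is then dominated by the affine
   function H(s) + (H(s) / s) t.  Concave majorants with H(0) >= 0 are
   star-shaped, and affine functions with nonnegative coefficients are concave
   and star-shaped, so either least majorant of f is finite at one s > 0 iff it
   is finite everywhere iff f has an affine bound.  Finally, the maximal rate
   has an affine bound iff all the individual rates do, and all the weights are
   positive. *)

Set Implicit Arguments.
Unset Strict Implicit.

(** * Finiteness of the least majorants and affine bounds *)

Section majorants.
Context {R : realType}.
Implicit Types (f H : R -> \bar R) (a b s t : R).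

Definition affinely_bounded f : Prop :=
  exists a b, [/\ (0 <= a)%R, (0 <= b)%R &
    majorizes (fun t => (a + b * t)%:E) f].

Lemma affine_concave a b : concave (fun t => (a + b * t)%:E).
Proof.
move=> -[x1 x2] [y1 y2] k; rewrite !inE /hypograph /= => -[x1_ge0 +] [y1_ge0 +].
have k0 : (0 <= k%:num)%R by [].
have k1 : (0 <= 1 - k%:num)%R by rewrite subr_ge0.
rewrite !lee_fin => hx hy; split; first by rewrite addr_ge0 ?mulr_ge0.
have := lerD (ler_wpM2l k0 hx) (ler_wpM2l k1 hy).
rewrite /unstable.onem /GRing.scale/=; lra.
Qed.

Lemma affine_star_shaped a b :
  (0 <= a)%R -> star_shaped (fun t => (a + b * t)%:E).
Proof.
move=> a_ge0; split=> [|[x y] k [/= x_ge0]].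
  by rewrite lee_fin mulr0 addr0.
rewrite lee_fin => xy /andP[k_ge0 k_le1]; split; rewrite /= ?mulr_ge0// lee_fin.
rewrite /GRing.scale/=; nra.
Qed.

(** Contracting a point by a factor is taking a convex combination with the origin, which lies in
    the hypograph as soon as [H] is nonnegative at 0. *)
Lemma concave_star_shaped H : 0 <= H 0%R -> concave H -> star_shaped H.
Proof.
move=> H0 cH; split=> // -[x y] k xyH /andP[k_ge0 k_le1].
have origin : hypograph H (0%R, 0%R) by split => //=.
have := cH (x, y) (0%R, 0%R) (Itv01 k_ge0 k_le1) (mem_set xyH) (mem_set origin).
move/set_mem; congr hypograph; congr pair.
  by rewrite /= /GRing.scale/= mulr0 addr0.
by rewrite /= /GRing.scale/= mulr0 addr0.
Qed.

Lemma star_shaped_affinely_bounded f H s : (0 < s)%R ->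
  {in Num.nneg &, {homo f : t u / (t <= u)%R >-> t <= u}} -> 0 <= f 0%R ->
  majorizes H f -> star_shaped H -> H s < +oo -> affinely_bounded f.
Proof.
move=> s_gt0 f_homo f0 fH [_ H_star] Hs.
have s_ge0 := ltW s_gt0.
have fs_ge0 : 0 <= f s by rewrite (le_trans f0) ?f_homo ?nnegrE.
have Hs_ge0 : 0 <= H s by rewrite (le_trans fs_ge0) ?fH.
move: Hs_ge0 Hs (fH s s_ge0) (H_star).
case HsE: (H s) => [h| |] //; rewrite lee_fin => h_ge0 _ fs_le _.
(* The constant [h] serves [t <= s], by monotonicity of [f]; the linear term alone serves
   [t >= s]. *)
exists h, (h / s)%R; split; rewrite ?divr_ge0// => t t_ge0.
have [ts|/ltW st] := leP t s.
  apply: (@le_trans _ _ (f s)); first by rewrite f_homo ?nnegrE.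
  by rewrite (le_trans fs_le)// lee_fin lerDl !mulr_ge0 ?invr_ge0.
have t_gt0 : (0 < t)%R by rewrite (lt_le_trans s_gt0).
have below y : y%:E <= H t -> (y <= h / s * t)%R.
  move=> yH; have [||/= _] := H_star (t, y) (s / t)%R.
  - by split.
  - by rewrite divr_ge0//= ler_pdivrMr ?mul1r.
  rewrite /GRing.scale/= divfK ?gt_eqF// HsE lee_fin.
  by rewrite mulrAC ler_pdivrMr// mulrAC ler_pdivlMr// mulrC.
apply: (le_trans (fH _ t_ge0)); move: below.
case: (H t) => [r| |] below; last by rewrite leNye.
  by rewrite lee_fin (le_trans (below r _)) ?lexx// lerDr.
(* If [H t] were +oo, every real would lie below it, in particular one exceeding the bound just
   proved. *)
by have := below (h / s * t + 1)%R (leey _); rewrite gerDl ler10.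
Qed.

Lemma least_star_majorant_lty f s :
  affinely_bounded f -> least_star_majorant f s < +oo.
Proof.
move=> [a [b [a_ge0 _ fab]]].
apply: (@le_lt_trans _ _ (a + b * s)%:E); last exact: ltry.
apply: ereal_inf_lbound; exists (fun t => (a + b * t)%:E) => //.
by split => //; exact: affine_star_shaped.
Qed.

Lemma least_concave_majorant_lty f s :
  affinely_bounded f -> least_concave_majorant f s < +oo.
Proof.
move=> [a [b [_ _ fab]]].
apply: (@le_lt_trans _ _ (a + b * s)%:E); last exact: ltry.
apply: ereal_inf_lbound; exists (fun t => (a + b * t)%:E) => //.
by split => //; exact: affine_concave.
Qed.

Section nondecreasing.
Variables (f : R -> \bar R) (s : R).
Hypothesis s_gt0 : (0 < s)%R.
Hypothesis f_homo : {in Num.nneg &, {homo f : t u / (t <= u)%R >-> t <= u}}.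
Hypothesis f0_ge0 : 0 <= f 0%R.

Lemma least_star_majorant_lty_bounded :
  least_star_majorant f s < +oo -> affinely_bounded f.
Proof.
move=> /ereal_inf_lt[_ [H [fH H_star] <-] Hs].
exact: (star_shaped_affinely_bounded s_gt0 f_homo f0_ge0 fH).
Qed.

Lemma least_concave_majorant_lty_bounded :
  least_concave_majorant f s < +oo -> affinely_bounded f.
Proof.
move=> /ereal_inf_lt[_ [H [fH H_concave] <-] Hs].
apply: (star_shaped_affinely_bounded s_gt0 f_homo f0_ge0 fH) => //.
by apply: concave_star_shaped => //; rewrite (le_trans f0_ge0) ?fH.
Qed.

(** Every majorant is at least [f s >= f 0] at [s]. This keeps the terms of [lb] away from -oo, so
    that a single infinite term decides the sum. *)
Lemma least_star_majorant_ge0 : 0 <= least_star_majorant f s.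
Proof.
apply: le_ereal_inf_tmp => _ [H [fH _] <-]; have s_ge0 := ltW s_gt0.
by rewrite (le_trans f0_ge0)// (le_trans _ (fH _ s_ge0))// f_homo ?nnegrE.
Qed.

End nondecreasing.
End majorants.

(** * Sign, monotonicity and affine bounds of the rates *)

Section rates.
Context {R : realType} {disp : measure_display} {Z : measurableType disp}
  {Theta : Type}.
Variables (d : Z * Z -> \bar R) (l : Z -> Theta -> R) (theta : Theta).

(** The point [z] itself is within reach and contributes a loss difference of 0. *)
Lemma individual_rate_ge0 z t : d (z, z) = 0 -> (0 <= t)%R ->
  0 <= individual_rate d l theta z t.
Proof.
by move=> dzz t_ge0; apply: ereal_sup_ubound; exists z; rewrite /= ?dzz ?subrr.
Qed.

Lemma le_individual_rate z :
  {homo individual_rate d l theta z : t u / (t <= u)%R >-> t <= u}.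
Proof.
move=> t u tu; apply: ereal_sup_le => _ [z' zt <-]; exists z' => //=.
by rewrite (le_trans zt) ?lee_fin.
Qed.

Variables (N : nat) (data : 'I_N -> Z).

Lemma le_maximal_rate :
  {homo maximal_rate d l theta data : t u / (t <= u)%R >-> t <= u}.
Proof. by move=> t u tu; apply: le_bigmax2 => i _; exact: le_individual_rate. Qed.

Lemma individual_rate_le_max i t :
  individual_rate d l theta (data i) t <= maximal_rate d l theta data t.
Proof. exact: le_bigmax. Qed.

Lemma maximal_rate_affinely_bounded (g : R -> R) :
  (forall i,
    affinely_bounded (fun t => individual_rate d l theta (data i) (g t))) ->
  affinely_bounded (fun t => maximal_rate d l theta data (g t)).
Proof.
move=> /choice[a] /choice[b] ab.
(* The coefficients are nonnegative, so their sums dominate each of them. *)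
exists (\sum_i a i)%R, (\sum_i b i)%R; split.
- by apply: sumr_ge0 => i _; have [] := ab i.
- by apply: sumr_ge0 => i _; have [] := ab i.
move=> t t_ge0; apply/bigmax_leP; split=> [|i _]; first exact: leNye.
have [_ _ /(_ t t_ge0) /le_trans] := ab i; apply; rewrite lee_fin lerD//.
  by rewrite (bigD1 i)//= lerDl sumr_ge0// => j _; have [] := ab j.
rewrite ler_wpM2r// (bigD1 i)//= lerDl sumr_ge0// => j _; by have [] := ab j.
Qed.

End rates.

(** Restricted to nonnegative arguments, since the power takes default values at negative ones. *)
Lemma powR_nneg_homo {R : realType} (f : R -> \bar R) (q : R) : (0 <= q)%R ->
  {homo f : t u / (t <= u)%R >-> t <= u} ->
  {in Num.nneg &, {homo (fun t => f (t `^ q)%R) : t u / (t <= u)%R >-> t <= u}}.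
Proof. by move=> q_ge0 f_homo t u t0 u0 tu; exact/f_homo/ge0_ler_powR. Qed.

(** An empty sum of masses would be 0, not 1. A nonempty data set makes the maximal rate nonnegative
    instead of the empty maximum -oo. *)
Lemma empirical_distribution_pos {R : realType} {disp : measure_display}
    {Z : measurableType disp} (N : nat) (data : 'I_N -> Z) (mu : 'I_N -> R)
    (P : probability Z R) :
  empirical_distribution data mu P -> (0 < N)%N.
Proof.
case: N data mu => // data mu [_ /(_ _ measurableT)].
by rewrite probability_setT big_ord0 => /eqP; rewrite onee_eq0.
Qed.

(** * The dichotomy for finite exponents *)

Lemma lb_cc_dichotomy {R : realType} {disp : measure_display}
    {Z : measurableType disp} {Theta : Type}
    (d : Z * Z -> \bar R) (l : Z -> Theta -> R) (theta : Theta)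
    (N : nat) (data : 'I_N -> Z) (mu : 'I_N -> R) (p : R) :
  (forall z, d (z, z) = 0) -> (0 < N)%N -> (forall i, (0 < mu i)%R) ->
  (0 < p)%R ->
  exactly_one
    (both_infinite (lb d l theta data mu p) (cc d l theta data p))
    (both_finite (lb d l theta data mu p) (cc d l theta data p)).
Proof.
move=> dzz N_gt0 mu_gt0 p_gt0; split; last first.
  by move=> [/(_ 1%R ltr01)[lb1 _] /(_ 1%R ltr01)[]]; rewrite lb1.
pose f i t := individual_rate d l theta (data i) (t `^ p^-1)%R.
pose fmax t := maximal_rate d l theta data (t `^ p^-1)%R.
have q_ge0 : (0 <= p^-1)%R by rewrite invr_ge0 ltW.
have zero_powR : (0 `^ p^-1 = 0 :> R)%R by rewrite powR0// invr_eq0 gt_eqF.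
have f_homo i := powR_nneg_homo q_ge0 (le_individual_rate d l theta (data i)).
have fmax_homo := powR_nneg_homo q_ge0 (le_maximal_rate d l theta data).
have f_ge0 i : 0 <= f i 0%R by rewrite /f zero_powR individual_rate_ge0.
have fmax_ge0 : 0 <= fmax 0%R.
  exact: le_trans (f_ge0 (Ordinal N_gt0)) (individual_rate_le_max _ _ _ _ _ _).
(* This criterion does not involve [eps], so each alternative settles all radii at once. *)
have [bounded|unbounded] := pselect (affinely_bounded fmax).
  right=> eps eps_gt0; split; last exact: least_concave_majorant_lty.
  apply: lte_sum_pinfty => i _; apply: lte_mul_pinfty => //.
    by rewrite lee_fin ltW.
  apply: least_star_majorant_lty; have [a [b [a_ge0 b_ge0 fab]]] := bounded.
  exists a, b; split => // t t_ge0.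
  exact: le_trans (individual_rate_le_max _ _ _ _ _ _) (fab t t_ge0).
left=> eps eps_gt0; have s_gt0 : (0 < eps `^ p)%R by rewrite powR_gt0.
split; last first.
  apply/eqP; rewrite -leye_eq leNgt; apply/negP => lty.
  exact/unbounded/(least_concave_majorant_lty_bounded s_gt0 fmax_homo fmax_ge0).
have [i fi_unbounded] : exists i, ~ affinely_bounded (f i).
  apply/existsNP => all_bounded; exact/unbounded/maximal_rate_affinely_bounded.
have star_ge0 j : 0 <= least_star_majorant (f j) (eps `^ p)%R.
  exact: least_star_majorant_ge0 s_gt0 (f_homo j) (f_ge0 j).
have star_i : least_star_majorant (f i) (eps `^ p)%R = +oo.
  apply/eqP; rewrite -leye_eq leNgt; apply/negP => lty.
  apply: fi_unbounded.
  exact: least_star_majorant_lty_bounded s_gt0 (f_homo i) (f_ge0 i) lty.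
(* The weight of [i] is positive, so its term is +oo; the remaining terms are nonnegative and cannot
   cancel it. *)
rewrite /lb (bigD1 i)//= -/(f i) star_i gt0_muley ?lte_fin//.
rewrite addye// -ltNye (lt_le_trans ltNy0)// sume_ge0// => j _.
by apply: mule_ge0 (star_ge0 j); rewrite lee_fin ltW.
Qed.

(** * Failure of the dichotomy for the infinite exponent *)

Section counterexample.
Context {R : realType}.

(* Relative to 0, the point n >= 1 has loss n at cost 1 + 1/n: within distance
   1 only 0 itself is reachable, while beyond 1 the losses are unbounded. *)
Definition jump (n : nat) : R := if n is 0%N then 0%R else (1 + n%:R^-1)%R.
(** The distance of the real line pulled back along the injective map [jump], hence a genuine
    metric. *)
Definition jump_cost (x : nat * nat) : \bar R := `|jump x.1 - jump x.2|%:E.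
Definition jump_loss (n : nat) (_ : unit) : R := n%:R.
Definition jump_data (_ : 'I_1) : nat := 0%N.
Definition jump_weight (_ : 'I_1) : R := 1%R.

Lemma jump_ground_cost : ground_cost jump_cost.
Proof.
split=> [|x|n]; rewrite /jump_cost ?lee_fin//= ?subrr ?normr0//.
apply/measurable_EFinP/measurableT_comp => //; apply: measurable_funB.
  exact: (measurableT_comp (f := jump)).
exact: (measurableT_comp (f := jump)).
Qed.

Lemma jump_empirical :
  empirical_distribution jump_data jump_weight (\d_0%N : probability nat R).
Proof. by split=> [i|A mA]; rewrite ?big_ord1 ?mul1e. Qed.

Lemma jump_cost0 n : jump_cost (n, 0%N) = (jump n)%:E.
Proof.
rewrite /jump_cost /= subr0 ger0_norm//.
by case: n => //= n; rewrite addr_ge0.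
Qed.

Lemma jump_rate_le1 t : (0 <= t <= 1)%R ->
  individual_rate jump_cost jump_loss tt 0%N t = 0.
Proof.
move=> /andP[t_ge0 t_le1]; apply/eqP; rewrite eq_le.
rewrite individual_rate_ge0 ?andbT//; last first.
  by rewrite jump_cost0.
apply: ge_ereal_sup => _ [[|n] + <-]; rewrite /= ?/jump_loss ?subrr//.
rewrite jump_cost0 lee_fin /= => /le_trans/(_ t_le1).
by rewrite gerDl leNgt invr_gt0 ltr0n.
Qed.

Lemma jump_rate_gt1 t : (1 < t)%R ->
  individual_rate jump_cost jump_loss tt 0%N t = +oo.
Proof.
move=> t_gt1; apply/eqyP => A A_gt0; apply: le_ereal_sup_tmp.
have inv_ge0 : (0 <= (t - 1)^-1)%R by rewrite invr_ge0 subr_ge0 ltW.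
(* Exceeding [A] makes the loss large enough; exceeding [(t - 1)^-1] brings the cost [1 + 1/(m+1)]
   down to at most [t]. The successor avoids the special point 0. *)
set m := Num.bound (A + (t - 1)^-1)%R.
have lt_m : (A + (t - 1)^-1 < m.+1%:R)%R.
  by rewrite (lt_le_trans (archi_boundP _)) ?addr_ge0 ?(ltW A_gt0)// ler_nat.
exists m.+1%:R%:E; last by rewrite lee_fin (le_trans _ (ltW lt_m))// lerDl.
exists m.+1 => /=; last by rewrite /jump_loss subr0.
rewrite jump_cost0 lee_fin /= -lerBrDl invf_ple ?posrE ?subr_gt0 ?ltr0n//.
by rewrite (le_trans _ (ltW lt_m))// lerDr ltW.
Qed.

Lemma jump_rate_right_limit :
  lim (individual_rate jump_cost jump_loss tt 0%N t @[t --> 1%R^'+]) = +oo.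
Proof.
apply: lim_near_cst => //.
by near=> t; apply: jump_rate_gt1; near: t; exact: nbhs_right_gt.
Unshelve. all: by end_near. Qed.

End counterexample.

Unset Implicit Arguments.
Set Strict Implicit.

Theorem corollary2 (R : realType) :
  (forall (disp : measure_display) (Z : measurableType disp) (Theta : Type)
      (d : Z * Z -> \bar R) (l : Z -> Theta -> R) (theta : Theta)
      (N : nat) (data : 'I_N -> Z) (mu : 'I_N -> R) (P : probability Z R)
      (p : R),
    ground_cost d ->
    empirical_distribution data mu P ->
    (1 <= p)%R ->
    exactly_one
      (both_infinite (lb d l theta data mu p) (cc d l theta data p))
      (both_finite (lb d l theta data mu p) (cc d l theta data p)))
  /\
  (* The dichotomy fails for p = +oo. *)
  (exists (disp : measure_display) (Z : measurableType disp) (Theta : Type)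
      (d : Z * Z -> \bar R) (l : Z -> Theta -> R) (theta : Theta)
      (N : nat) (data : 'I_N -> Z) (mu : 'I_N -> R) (P : probability Z R),
    [/\ ground_cost d,
        empirical_distribution data mu P,
        (exists (i : 'I_N) (eps : R),
          [/\ (0 < eps)%R,
              individual_rate d l theta (data i) eps < +oo &
              lim (individual_rate d l theta (data i) t @[t --> eps^'+]) = +oo])
      & ~ exactly_one
          (both_infinite (lb_infty d l theta data mu) (cc_infty d l theta data mu))
          (both_finite (lb_infty d l theta data mu) (cc_infty d l theta data mu))]).

Proof.
split=> [disp Z Theta d l theta N data mu P p [_ _ dzz] dataP p_ge1|].
  apply: lb_cc_dichotomy => //.
  - exact: empirical_distribution_pos dataP.
  - by case: dataP.
  - exact: lt_le_trans p_ge1.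
exists _, nat, unit, jump_cost, jump_loss, tt, 1%N, jump_data, jump_weight.
exists (\d_0%N : probability nat R).
have rate1 : individual_rate jump_cost jump_loss tt 0%N 1%R = 0 :> \bar R.
  by rewrite jump_rate_le1// ler01 lexx.
split; [exact: jump_ground_cost|exact: jump_empirical| |].
  by exists ord0, 1%R; rewrite rate1 jump_rate_right_limit.
(* With one point of weight 1, at radius 1 [lb_infty] is 0 and [cc_infty] is +oo, which refutes both
   cases. *)
move=> [[inf|fin] _].
  by have [] := inf 1%R ltr01; rewrite /lb_infty big_ord1 rate1 mule0.
have [_] := fin 1%R ltr01.
by rewrite /cc_infty big_ord1 jump_rate_right_limit mul1e.
Qed.
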